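(* Let $S$ be a finite nonempty data set whose data points have attributes $a_1,\dots,a_n$, each attribute $a_i$ having a distinguished set of favorable values, and let a data point be labeled ''creditworthy'' if and only if its value is favorable for every attribute $a_1,\dots,a_n$ (otherwise ''not creditworthy''). Build a decision tree from the labeled data set $S$ by the greedy Gini algorithm described in the context. For a nonempty $S'\subseteq S$ let $p_i(S')$ denote the fraction of data points of $S'$ having a favorable value for $a_i$, and let $p_i=p_i(S)$. (1) Suppose the attributes are statistically independent of each other in $S$ and $p_{i_1}<p_{i_2}<\dots<p_{i_n}$ for an enumeration $i_1,\dots,i_n$ of $\{1,\dots,n\}$. Then this ordering is the order in which the attributes are used in the decision tree from root to leaf: every non-leaf node at level $j$ (the root being at level $1$) is split on the attribute $a_{i_j}$. (2) If the attributes are not assumed to be independent, then at every non-leaf node $v$ of the tree, with $S(v)$ the subset of data points reaching $v$, the attribute chosen for the split at $v$ is one for which $p_i(S(v))$ is minimal among the attributes still available at $v$ (those not used on the path from the root to $v$).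
   Context: Statistical independence of the attributes in $S$ means mutual independence under the empirical distribution: for every set $J$ of attribute indices, the fraction of data points of $S$ that have a favorable value for all $a_i$, $i\in J$, is $\prod_{i\in J}p_i$. Gini index: for a data set $S'$ with binary label $y$, $\mathrm{Gini}(y,S')=1-\sum_{c}q_c^2$, where $q_c$ is the fraction of elements of $S'$ with label $c$. Gini impurity of a split: each attribute $a$ splits a data set $S'$ into the part with a favorable value for $a$ and the part with an unfavorable value for $a$; the (weighted) Gini impurity of this split is $\mathrm{G}(a,S')=\sum_{T}\frac{|T|}{|S'|}\,\mathrm{Gini}(y,T)$, the sum running over the nonempty parts $T$. Greedy Gini (CART) algorithm: every node $v$ carries a data set $S(v)$ and a list of available attributes; the root carries $S$ and all attributes. If all points of $S(v)$ have the same label or no attributes are available, $v$ is a leaf, labeled with the majority label. Otherwise $v$ is split on an available attribute $a$ minimizing $\mathrm{G}(a,S(v))$, and its children carry the resulting (nonempty) parts of $S(v)$ and the list of available attributes with $a$ removed. *)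

(* Defs.v *)
From mathcomp Require Import all_boot all_order all_algebra all_fingroup.

Set Implicit Arguments.
Unset Strict Implicit.
Unset Printing Implicit Defensive.

Import Order.TTheory GRing.Theory Num.Theory.
Local Open Scope ring_scope.

(* The elements of D are identities of data points, so distinct points of a
   data set may agree on all attributes.  Attribute i takes its values in V i,
   and fav i is its distinguished set of favorable values. *)
Section DataSets.
Variables (n : nat) (D : finType) (V : 'I_n -> Type).
Variables (attr : forall i, D -> V i) (fav : forall i, pred (V i)).
Implicit Types (S : {set D}) (i a : 'I_n) (b c : bool) (y P : pred D).

Definition favorable i : pred D := fun x => fav (attr i x).

Definition creditworthy : pred D := fun x => [forall i, favorable i x].

Definition frac P S : rat := #|[set x in S | P x]|%:R / #|S|%:R.

Definition pfav i S : rat := frac (favorable i) S.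

Definition independent_attributes S : Prop :=
  forall J : {set 'I_n},
    frac (fun x => [forall (i | i \in J), favorable i x]) S
    = \prod_(i in J) pfav i S.

Definition part a b S : {set D} := [set x in S | favorable a x == b].

Definition gini y S : rat := 1 - \sum_(c : bool) frac (fun x => y x == c) S ^+ 2.

Definition gini_impurity y a S : rat :=
  \sum_(b | part a b S != set0)
     #|part a b S|%:R / #|S|%:R * gini y (part a b S).

(* Each node carries its data set and its set of available attributes.  The
   child at b receives the points whose favorability equals b; it is None
   when there are no such points. *)
Inductive dtree : Type :=
| LeafNode of {set D} & {set 'I_n} & bool
| SplitNode of {set D} & {set 'I_n} & 'I_n & (bool -> option dtree).

Definition terminal y S (A : {set 'I_n}) : bool :=
  [forall x in S, forall z in S, y x == y z] || (A == set0).

(* Both labels are majority labels in case of a tie. *)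
Definition majority y S c : bool :=
  (#|[set x in S | y x != c]| <= #|[set x in S | y x == c]|)%N.

(* A relation rather than a function, since several available attributes may
   minimize the impurity: it holds of every tree the algorithm can output. *)
Inductive greedy_tree y : {set D} -> {set 'I_n} -> dtree -> Prop :=
| greedy_leaf S A c of terminal y S A & majority y S c :
    greedy_tree y S A (LeafNode S A c)
| greedy_split S A a (children : bool -> option dtree) of
    ~~ terminal y S A & a \in A
    & (forall i, i \in A -> gini_impurity y a S <= gini_impurity y i S)
    & (forall b, children b = None <-> part a b S = set0)
    & (forall b t, children b = Some t ->
         greedy_tree y (part a b S) (A :\ a) t) :
    greedy_tree y S A (SplitNode S A a children).

End DataSets.

Arguments LeafNode {n D}.
Arguments SplitNode {n D}.

(* node_at t l v: v is (the subtree rooted at) a node of t at level l, the root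
   being at level 1. *)
Inductive node_at (n : nat) (D : finType) (t : dtree n D) :
  nat -> dtree n D -> Prop :=
| node_root : node_at t 1%N t
| node_child l S A a children b u of
    node_at t l (SplitNode S A a children) & children b = Some u :
    node_at t l.+1 u.

(* Main.v *)
(* A creditworthy point is favorable for every attribute, so the unfavorable part
   of a split is pure.  If K > 0 of the N points at a node are creditworthy and m
   of them are favorable for a, the impurity of a is
   (m/N) * 2(K/m)(1 - K/m) = 2(K/N)(1 - K/m), which increases with m, i.e. with
   p_a.  A non-leaf node contains a creditworthy point, hence is reached through
   favorable branches only: its data set is cut out by the attributes already
   used, so by independence p_i has the same value there as at the root. *)
Require Import Defs.
From mathcomp Require Import all_boot all_order all_algebra all_fingroup.
From mathcomp Require Import ring.

Set Implicit Arguments.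
Unset Strict Implicit.
Unset Printing Implicit Defensive.

Import Order.TTheory GRing.Theory Num.Theory.
Local Open Scope ring_scope.

Section GreedyGini.
Variables (n : nat) (D : finType) (V : 'I_n -> Type).
Variables (attr : forall i, D -> V i) (fav : forall i, pred (V i)).
Implicit Types (S T : {set D}) (A : {set 'I_n}) (a i : 'I_n) (y P Q : pred D).

Local Notation frac := Defs.frac.
Local Notation good := (creditworthy attr fav).
Local Notation fav_at := (favorable attr fav).
Local Notation p_ := (pfav attr fav).

Lemma card_neq0 S : S != set0 -> #|S|%:R != 0 :> rat.
Proof. by rewrite pnatr_eq0 cards_eq0. Qed.

Lemma frac_gt0 P S x : x \in S -> P x -> 0 < frac P S.
Proof.
move=> xS Px; rewrite divr_gt0 // ltr0n; apply/card_gt0P; exists x => //.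
by rewrite inE xS.
Qed.

Lemma eq_frac P Q S : {in S, P =1 Q} -> frac P S = frac Q S.
Proof.
move=> PQ; rewrite /frac; congr (_%:R / _); apply: eq_card => x.
by rewrite !inE; case: (boolP (x \in S)) => //= /PQ ->.
Qed.

Lemma fracC P S : S != set0 -> frac (predC P) S = 1 - frac P S.
Proof.
move=> /card_neq0 S0; apply/eqP; rewrite eq_sym subr_eq /frac -mulrDl -natrD.
have -> : [set x in S | predC P x] = S :\: [set x in S | P x].
  by apply/setP=> x; rewrite !inE; case: (x \in S); rewrite //= andbT.
have sub : [set x in S | P x] \subset S by apply/subsetP=> x /setIdP[].
by rewrite cardsDS // subnK ?subset_leq_card // divff.
Qed.

(** The chain rule for conditional fractions. The product form needs no nonemptiness assumption: if
    no point of [S] satisfies [Q], both sides are 0. *)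
Lemma frac_setId P Q S :
  frac P [set x in S | Q x] * frac Q S = frac (predI P Q) S.
Proof.
rewrite /frac; set T := [set x in S | Q x]; set U := [set x in S | _].
have -> : [set x in T | P x] = U.
  by apply/setP=> x; rewrite !inE -andbA (andbC (Q x)).
have sUT : U \subset T.
  by apply/subsetP=> x; rewrite !inE => /and3P[-> _ ->].
have [T0|/card_neq0 T0] := eqVneq T set0.
  by move: sUT; rewrite T0 subset0 => /eqP->; rewrite cards0 !mul0r.
by rewrite mulrA divfK.
Qed.

Lemma gini_frac y S : S != set0 -> gini y S = 2 * frac y S * (1 - frac y S).
Proof.
move=> S0; rewrite /gini big_bool /=.
rewrite (@eq_frac (fun x => y x == true) y) => [|x _]; last by rewrite eqb_id.
rewrite (@eq_frac (fun x => y x == false) (predC y)) => [|x _];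
  last exact: eqbF_neg.
rewrite fracC //; ring.
Qed.

Lemma frac_creditworthy_unfavorable a S : frac good (part attr fav a false S) = 0.
Proof.
rewrite /frac; set U := [set x in _ | _].
suff -> : U = set0 by rewrite cards0 mul0r.
apply/setP=> x; rewrite !inE; apply/negP => /andP[/andP[_ /eqP ax] /forallP/(_ a)].
by rewrite ax.
Qed.

Lemma frac_creditworthy_favorable a S :
  frac good (part attr fav a true S) * p_ a S = frac good S.
Proof.
have -> : part attr fav a true S = [set x in S | fav_at a x].
  by apply/setP=> x; rewrite !inE eqb_id.
rewrite frac_setId; apply: eq_frac => x _ /=.
by case: (boolP (good x)) => //= /forallP->.
Qed.

Lemma gini_impurity_creditworthy a S : p_ a S != 0 ->
  gini_impurity attr fav good a S
  = 2 * frac good S * (1 - frac good S / p_ a S).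
Proof.
move=> pa0; rewrite /gini_impurity big_mkcond big_bool /=.
have pE : #|part attr fav a true S|%:R / #|S|%:R = p_ a S.
  rewrite /pfav /frac; congr (_%:R / _); apply: eq_card => x.
  by rewrite !inE eqb_id.
have T0 : part attr fav a true S != set0.
  by apply: contraNneq pa0 => T0; rewrite -pE T0 cards0 mul0r.
rewrite T0 pE gini_frac //.
(* The unfavorable part contributes 0 whether or not it is empty, since all its points are labeled
   not creditworthy. *)
rewrite [X in _ + X](_ : _ = 0) ?addr0; last first.
  case: ifP => // F0.
  by rewrite gini_frac // frac_creditworthy_unfavorable !(mulr0, mul0r).
(* Expressing [frac good S] as a multiple of [p_ a S] cancels the division and leaves a polynomial
   identity. *)
rewrite -(frac_creditworthy_favorable a S) mulfK //; ring.
Qed.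

Lemma pfav_gt0 a S x : x \in S -> good x -> 0 < p_ a S.
Proof. by move=> xS /forallP gx; apply: frac_gt0 xS _. Qed.

(** The creditworthy point [x] makes [frac good S] and both [p_] values positive, so the closed form
    of the impurity is strictly increasing in [p_]. *)
Lemma gini_impurity_le a i S x : x \in S -> good x ->
  (gini_impurity attr fav good a S <= gini_impurity attr fav good i S)
  = (p_ a S <= p_ i S).
Proof.
move=> xS gx; have K0 : 0 < frac good S by apply: frac_gt0 xS gx.
have pa := pfav_gt0 a xS gx; have pi := pfav_gt0 i xS gx.
have K2 : 0 < 2 * frac good S by rewrite pmulr_rgt0.
rewrite !gini_impurity_creditworthy ?gt_eqF // (ler_pM2l K2).
by rewrite lerD2l lerN2 (ler_pM2l K0) lef_pV2 ?posrelE.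
Qed.

(** Two points of [S] carry different labels, so one of them is creditworthy. *)
Lemma nonterminal_creditworthy S A :
  ~~ terminal good S A -> exists2 x, x \in S & good x.
Proof.
case/norP => /forall_inPn[x xS /forall_inPn[z zS xz]] _.
by case: (boolP (good x)) xz => gx; [exists x | case: (boolP (good z)); [exists z|]].
Qed.

Lemma greedy_tree_split y S A S' A' a (ch : bool -> option (dtree n D)) :
  greedy_tree attr fav y S A (SplitNode S' A' a ch) ->
  [/\ S = S' /\ A = A', ~~ terminal y S A, a \in A,
      forall i, i \in A ->
        gini_impurity attr fav y a S <= gini_impurity attr fav y i S
    & forall b t, ch b = Some t ->
        greedy_tree attr fav y (part attr fav a b S) (A :\ a) t].
Proof. by move=> g; inversion g; subst. Qed.

Lemma greedy_split_pfav S A S' A' a (ch : bool -> option (dtree n D)) :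
  greedy_tree attr fav good S A (SplitNode S' A' a ch) ->
  a \in A /\ forall i, i \in A -> p_ a S <= p_ i S.
Proof.
case/greedy_tree_split=> _ /nonterminal_creditworthy[x xS gx] aA mina _.
by split=> // i /mina; rewrite (gini_impurity_le a i xS gx).
Qed.

Lemma node_at_greedy y S A t l u :
  greedy_tree attr fav y S A t -> node_at t l u ->
  exists Sv Av, greedy_tree attr fav y Sv Av u.
Proof.
move=> gt; elim=> [|{u}l' S' A' a ch b u _ [Sv [Av gv]] chb]; first by exists S, A.
by case: (greedy_tree_split gv) => _ _ _ _ /(_ _ _ chb); eexists; eexists; eauto.
Qed.

(** The data set at the end of a path of favorable branches along which exactly the attributes
    outside [A] were used. *)
Definition reach S A : {set D} :=
  [set x in S | [forall (i | i \in ~: A), fav_at i x]].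

Lemma reach_setT S : reach S [set: 'I_n] = S.
Proof.
apply/setP=> x; rewrite !inE andb_idr // => _; apply/forall_inP=> i.
by rewrite setCT inE.
Qed.

Lemma part_reach S A a : a \in A ->
  part attr fav a true (reach S A) = reach S (A :\ a).
Proof.
move=> aA; apply/setP=> x; rewrite !inE eqb_id -andbA; congr (_ && _).
apply/andP/forall_inP => [[/forall_inP H ax] i | H].
  rewrite !inE negb_and negbK => /orP[/eqP->// | iA].
  by apply: H; rewrite inE.
split; last by apply: H; rewrite !inE eqxx.
by apply/forall_inP=> i; rewrite inE => iA; apply: H; rewrite !inE (negPf iA) andbF.
Qed.

(** Independence for [~: A] and for [i |: ~: A] gives two products that differ by the factor
    [p_ i S]. Nonemptiness of [reach S A] allows the common factor to be cancelled. *)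
Lemma pfav_reach S A i : independent_attributes attr fav S ->
  i \in A -> reach S A != set0 -> p_ i (reach S A) = p_ i S.
Proof.
move=> ind iA R0.
have S0 : S != set0.
  by apply: contraNneq R0 => ->; apply/eqP/setP=> x; rewrite !inE.
have f0 : frac (fun x => [forall (k | k \in ~: A), fav_at k x]) S != 0.
  by rewrite mulf_neq0 ?invr_eq0 // card_neq0.
apply: (mulIf f0); rewrite {1}/pfav frac_setId.
have := ind (i |: ~: A); rewrite big_setU1 ?inE ?iA //= -ind => <-.
apply: eq_frac => x _ /=; apply/andP/forall_inP => [[ix /forall_inP H] k | H].
  by rewrite in_setU1 => /predU1P[->//|/H].
split; first by apply: H; rewrite setU11.
by apply/forall_inP=> k kA; apply: H; rewrite in_setU1 kA orbT.
Qed.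

Section Independent.
Variables (S : {set D}) (s : 'S_n).
Hypothesis ind : independent_attributes attr fav S.
Hypothesis incr : forall j k : 'I_n, (j < k)%N -> p_ (s j) S < p_ (s k) S.

(** The last hypothesis says that the first [l.-1] attributes of the enumeration are used up. Any
    later choice than the next one would contradict minimality, as [p_] agrees on [Sv] and [S] for
    available attributes. *)
Lemma reach_split_attribute l Sv A S' A' a (ch : bool -> option (dtree n D)) :
  greedy_tree attr fav good Sv A (SplitNode S' A' a ch) -> Sv = reach S A ->
  (0 < l)%N -> (forall j : 'I_n, (s j \in A) = (l <= j.+1)%N) ->
  exists2 j : 'I_n, l = j.+1 & a = s j.
Proof.
move=> g eSv l0 hA; have [aA mina] := greedy_split_pfav g.
have R0 : reach S A != set0.
  case: (greedy_tree_split g) => _ /nonterminal_creditworthy[x xS _] _ _ _.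
  by apply/set0Pn; exists x; rewrite -eSv.
have [k ak] : exists k, a = s k by exists ((s^-1)%g a); rewrite permKV.
have := hA k; rewrite -ak aA => /esym; rewrite leq_eqVlt => /predU1P[lk|lk].
  by exists k.
(* Levels start at 1 and ordinals at 0, so the attribute due at level [l] has index [l.-1]. *)
have ln : (l.-1 < n)%N.
  by apply: leq_ltn_trans (ltn_ord k); rewrite -ltnS prednK // ltnW.
have jA : s (Ordinal ln) \in A by rewrite hA /= prednK.
have := mina _ jA; rewrite eSv !(pfav_reach ind) // leNgt ak incr //=.
by rewrite -ltnS prednK.
Qed.

(** The invariant is conditional because it can fail below an unfavorable branch. No creditworthy
    point gets there, so such nodes are leaves. *)
Lemma node_at_reach t l u :
  greedy_tree attr fav good S [set: 'I_n] t -> node_at t l u ->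
  exists Sv Av, [/\ greedy_tree attr fav good Sv Av u, (0 < l)%N &
    (exists2 x, x \in Sv & good x) ->
    Sv = reach S Av /\ forall j : 'I_n, (s j \in Av) = (l <= j.+1)%N].
Proof.
move=> gt; elim=> [|{u}l' S' A' a ch b u _ [Sv [Av [gv l0 hv]]] chb].
  exists S, [set: 'I_n]; split=> // _; rewrite reach_setT; split=> // j.
  by rewrite inE.
case: (greedy_tree_split gv) => _ _ aA _ /(_ _ _ chb) gu.
exists (part attr fav a b Sv), (Av :\ a); split=> // -[x].
rewrite inE => /andP[xS /eqP <-] gx.
(* The creditworthy point of the child also lies in the parent, so the invariant holds there; it
   also forces the branch to be the favorable one. *)
have [|eSv hA] := hv; first by exists x.
have [k lk ak] := reach_split_attribute gv eSv l0 hA.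
have -> : fav_at a x = true by move/forallP: gx => ->.
split=> [|j]; first by rewrite {1}eSv part_reach.
(* Removing [s k] from the attributes of index at least [k] leaves those of index greater than
   [k]. *)
by rewrite in_setD1 hA ak (inj_eq perm_inj) lk !ltnS [RHS]ltn_neqAle eq_sym.
Qed.

End Independent.

End GreedyGini.

Theorem theorem1 (n : nat) (D : finType) (V : 'I_n -> Type)
    (attr : forall i, D -> V i) (fav : forall i, pred (V i))
    (S : {set D}) (hS : S != set0)
    (t : dtree n D)
    (ht : greedy_tree attr fav (creditworthy attr fav) S [set: 'I_n] t) :
  (independent_attributes attr fav S ->
   forall s : 'S_n,
     (forall j k : 'I_n, (j < k)%N ->
        pfav attr fav (s j) S < pfav attr fav (s k) S) ->
     forall (l : nat) (Sv : {set D}) (A : {set 'I_n}) (a : 'I_n)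
       (children : bool -> option (dtree n D)),
       node_at t l (SplitNode Sv A a children) ->
       exists2 j : 'I_n, l = j.+1 & a = s j)
  /\
  (forall (l : nat) (Sv : {set D}) (A : {set 'I_n}) (a : 'I_n)
     (children : bool -> option (dtree n D)),
     node_at t l (SplitNode Sv A a children) ->
     a \in A /\ (forall i, i \in A -> pfav attr fav a Sv <= pfav attr fav i Sv)).
Proof.
split=> [ind s incr | ] l Sv A a ch nd; last first.
  have [S' [A' g]] := node_at_greedy ht nd.
  case: (greedy_tree_split g) => -[eS eA] _ _ _ _; rewrite -eS -eA.
  exact: greedy_split_pfav g.
have [S' [A' [g l0 reachS']]] := node_at_reach ind incr ht nd.
have [_ nt _ _ _] := greedy_tree_split g.
(* A split node is not terminal, which supplies the creditworthy point the invariant asks for. *)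
have [eS' hA'] := reachS' (nonterminal_creditworthy nt).
exact: reach_split_attribute ind incr _ _ _ _ _ _ _ g eS' l0 hA'.
Qed.
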